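(* Let $G$ be a connected graph with $n$ vertices, let $\lambda$ be a partition of $n$, and let $\beta,\gamma$ be real numbers. Then the multiplicity of the root $\beta$ in the polynomial $\operatorname{Imm}_{\lambda}(xI-\beta D(G)-\gamma A(G))$ is greater than or equal to the star degree of $G$.
   Context: Graphs are finite and simple. $D(G)$ is the diagonal degree matrix and $A(G)$ the adjacency matrix of $G$; $I$ is the $n\times n$ identity matrix. For a partition $\lambda$ of $n$, $\chi_\lambda$ is the irreducible character of the symmetric group $\mathcal{S}_n$ indexed by $\lambda$, and $\operatorname{Imm}_\lambda(M)=\sum_{\sigma\in\mathcal{S}_n}\chi_\lambda(\sigma)\prod_{i=1}^n m_{i\sigma(i)}$ for an $n\times n$ matrix $M=[m_{ij}]$. A pendant vertex is a vertex of degree 1. A pendant star of $G$ is a maximal subgraph consisting of pendant edges all incident to the same vertex, called its centre. The degree of a pendant star is the number of its pendant vertices (those adjacent to the centre) minus one. The star degree of $G$ is the sum of the degrees of all its pendant stars, or $0$ if there are none. The multiplicity of $\beta$ is $0$ if $\beta$ is not a root. *)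

(* Defs.v *)
From HB Require Import structures.
From mathcomp Require Import all_boot all_order all_algebra.
From mathcomp Require Import all_fingroup all_character.
From mathcomp Require Import complex.
From mathcomp Require Import reals.

Set Implicit Arguments.
Unset Strict Implicit.
Unset Printing Implicit Defensive.

Import GRing.Theory.

Local Open Scope ring_scope.

Definition is_partition (n : nat) (la : seq nat) : bool :=
  [&& sorted geq la, 0%N \notin la & sumn la == n].

(* The Young diagram of la is filled row by row with 0, ..., n-1, so that the
   entry i lies in row [reshape_index la i] and column [reshape_offset la i]. *)

Definition row_stab (n : nat) (la : seq nat) : {set 'S_n} :=
  [set s : 'S_n | [forall i : 'I_n,
     reshape_index la (s i) == reshape_index la i]].

Definition col_stab (n : nat) (la : seq nat) : {set 'S_n} :=
  [set s : 'S_n | [forall i : 'I_n,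
     reshape_offset la (s i) == reshape_offset la i]].

Section SymmetricGroupCharacters.

Variables (F : fieldType) (n : nat) (la : seq nat).

Let regS := regular_repr F [set: 'S_n].

(* The element (sum of the row stabiliser) * (signed sum of the column
   stabiliser) of the group algebra.  MathComp permutations act on the right,
   so the right ideal (sum of the row stabiliser) F[S_n] is the permutation
   module on the tabloids of shape la, and this element is the polytabloid of
   the tableau above. *)
Definition polytabloid : 'rV[F]_#|[set: 'S_n]| :=
  gring_row ((\sum_(r in row_stab n la) regS r)
             *m (\sum_(c in col_stab n la) (-1) ^+ c *: regS c)).

Definition specht_repr :=
  submod_repr (cyclic_mx_module regS polytabloid).

Definition specht_char (s : 'S_n) : F := \tr (specht_repr s).

Definition immanant (A : comAlgType F) (M : 'M[A]_n) : A :=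
  \sum_(s : 'S_n) specht_char s *: \prod_(i < n) M i (s i).

End SymmetricGroupCharacters.

Section Graphs.

(* [e] is the adjacency relation. *)
Variables (n : nat) (e : rel 'I_n).

Definition simple_graph : Prop := symmetric e /\ irreflexive e.

Definition connected_graph : Prop :=
  (0 < n)%N /\ forall u v : 'I_n, connect e u v.

Definition deg (v : 'I_n) : nat := #|[set u | e v u]|.

Definition degree_mx (F : fieldType) : 'M[F]_n :=
  diag_mx (\row_i (deg i)%:R).

Definition adjacency_mx (F : fieldType) : 'M[F]_n :=
  \matrix_(i, j) (e i j)%:R.

Definition pendant (v : 'I_n) : bool := deg v == 1%N.

Definition pendant_edge (f : {set 'I_n}) : bool :=
  [exists u, exists v, [&& pendant u, e u v & f == [set u; v]]].

Definition concurrent_pendant_edges (H : {set {set 'I_n}}) : bool :=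
  [exists c, forall f in H, pendant_edge f && (c \in f)].

(* A pendant star is identified with its (nonempty) set of edges. *)
Definition pendant_stars : {set {set {set 'I_n}}} :=
  [set H | (H != set0) && maxset concurrent_pendant_edges H].

(* A star with a single edge {c, p} is centred at c when p is pendant; the
   centre of a pendant star is unique unless the graph is a single edge, where
   both vertices qualify. *)
Definition star_centre (H : {set {set 'I_n}}) (c : 'I_n) : bool :=
  [forall f in H, exists p, [&& pendant p, e p c & f == [set p; c]]].

Definition star_leaves (H : {set {set 'I_n}}) (c : 'I_n) : {set 'I_n} :=
  [set p | pendant p & [set p; c] \in H].

(* Every pendant star has a centre, and the value does not depend on it. *)
Definition pendant_star_degree (H : {set {set 'I_n}}) : nat :=
  if [pick c | star_centre H c] is Some c then #|star_leaves H c|.-1 else 0%N.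

Definition star_degree : nat :=
  \sum_(H in pendant_stars) pendant_star_degree H.

End Graphs.

(* Main.v *)
Require Import Defs.
From mathcomp Require Import all_boot all_order all_algebra.
From mathcomp Require Import all_fingroup all_character.
From mathcomp Require Import complex.
From mathcomp Require Import reals.

(** Why the bound holds.  Write M = xI - beta D - gamma A.  In the row of a
    pendant vertex p with neighbour c, the only entries that can be nonzero are
    x - beta on the diagonal and -gamma in column c.  So if the term of a permutation s in
    the expansion of the immanant is nonzero, s sends each leaf of a pendant
    star either to itself or to the centre of the star; as s is injective, at
    most one leaf of each star moves.  Distinct pendant stars have disjoint sets
    of leaves, hence s fixes at least as many pendant vertices as the star degree
    ([star_degree_fixed]), and each of them contributes a factor x - beta.  Every
    term is thus divisible by the required power of x - beta, whatever the
    coefficients chi(s) are.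

    The library multiplicity of a root of the zero polynomial is 0, so it must
    also be shown that the immanant does not vanish.  Its coefficient of x^n is
    chi(1) ([coef_immanant_charmx]), the dimension of the Specht module, which is
    nonzero in characteristic 0 because the generating polytabloid has
    coefficient 1 at the identity ([polytabloid_neq0]). *)

Set Implicit Arguments.
Unset Strict Implicit.
Unset Printing Implicit Defensive.

Import GRing.Theory Num.Theory.

Local Open Scope ring_scope.
Local Open Scope complex_scope.

(** The bound on the size is what makes the induction for the top coefficient
    go through: the constant term of a new factor cannot reach degree
    [(size r).+1]. *)
Lemma prod_linear_coef (R : comNzRingType) (I : Type) (r : seq I)
    (P : I -> {poly R}) :
  (forall i, size (P i) <= 2)%N ->
  (size (\prod_(i <- r) P i)%R <= (size r).+1)%N
  /\ (\prod_(i <- r) P i)`_(size r) = \prod_(i <- r) (P i)`_1.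
Proof.
move=> szP; elim: r => [|i r [szr coefr]] /=.
  by rewrite !big_nil coef1 size_poly1.
rewrite !big_cons; split.
  apply: (leq_trans (size_polyMleq _ _)).
  by rewrite -subn1 leq_subLR add1n -[(size r).+3]add2n leq_add.
have -> : P i = (P i)`_1 *: 'X + ((P i)`_0)%:P.
  apply/polyP=> k; rewrite coefD coefZ coefX coefC.
  case: k => [|[|k]] /=; rewrite ?mulr0 ?mulr1 ?addr0 ?add0r //.
  by rewrite nth_default // (leq_trans (szP i)).
rewrite mulrDl coefD -scalerAl coefZ coefXM coefCM /= coefr.
rewrite [X in _ + _ * X]nth_default // mulr0 addr0.
by rewrite coefD coefZ coefX coefC /= mulr1 addr0.
Qed.

(** The term of a permutation s has degree at most the number of fixed points of
    s, so only the identity contributes to the coefficient of x^n. *)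
Lemma coef_immanant_charmx (F : fieldType) (n : nat) (la : seq nat)
    (B : 'M[F]_n) :
  (immanant la ('X%:M - map_mx polyC B : 'M[{poly F}]_n))`_n
    = specht_char F la (1%g : 'S_n).
Proof.
set M := (X in immanant la X).
have entry i j : M i j = 'X *+ (i == j) - (B i j)%:P by rewrite !mxE.
have szM i j : (size (M i j) <= 2)%N.
  rewrite entry (leq_trans (size_polyD _ _)) // geq_max size_polyN.
  rewrite (leq_trans (size_polyC_leq1 _)) // andbT.
  by case: (i == j); rewrite ?mulr0n ?size_poly0 // mulr1n size_polyX.
have coef_term (s : 'S_n) : (\prod_i M i (s i))`_n = \prod_i (i == s i)%:R.
  have [_] := prod_linear_coef (enum 'I_n) (fun i => szM i (s i)).
  rewrite size_enum_ord !big_enum => ->; apply: eq_bigr => i _.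
  by rewrite entry coefB coefMn coefX coefC subr0.
rewrite /immanant coef_sum (bigD1 1%g) //= [X in _ + X]big1 ?addr0 => [|s s1].
  by rewrite coefZ coef_term big1 ?mulr1 // => i _; rewrite perm1 eqxx.
have [i si] : exists i, s i != i.
  apply/existsP; apply: contraNT s1 => /existsPn fix_s.
  by apply/eqP/permP=> i; rewrite perm1; apply/eqP/negPn/fix_s.
by rewrite coefZ coef_term (bigD1 i) //= eq_sym (negPf si) mul0r mulr0.
Qed.

(** A cell of a tableau is determined by its row and its column.  From r c = 1,
    the permutation c is the inverse of r, so it preserves rows as well as
    columns. *)
Lemma row_col_stab_eq1 (n : nat) (la : seq nat) (r c : 'S_n) :
  r \in row_stab n la -> c \in col_stab n la -> (r * c)%g = 1%g -> c = 1%g.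
Proof.
rewrite !inE => /forallP rowr /forallP colc rc1.
apply/permP=> i; rewrite perm1; apply: val_inj => /=.
have rci : r (c i) = i.
  by rewrite -permM -(mulg1_eq rc1) mulVg perm1.
rewrite -(reshape_indexK la (c i)) (eqP (colc i)).
by rewrite -(eqP (rowr (c i))) rci reshape_indexK.
Qed.

(** The coefficient at the identity of the group algebra is the signed count of
    the pairs (r, c) of row and column stabilisers with r c = 1, and the only
    such pair is (1, 1). *)
Lemma polytabloid_neq0 (F : fieldType) (n : nat) (la : seq nat) :
  polytabloid F n la != 0.
Proof.
pose one := gring_index [set: 'S_n] 1%g.
suff: polytabloid F n la 0 one = 1.
  move=> coef1; apply/eqP=> p0; move/eqP: coef1.
  by rewrite p0 mxE eq_sym oner_eq0.
have coefM r c : (regular_repr F [set: 'S_n] r *m regular_repr F [set: 'S_n] c)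
    one one = (r * c == 1)%g%:R.
  rewrite -repr_mxM ?inE // !mxE /one.
  rewrite gring_indexK ?inE // mul1g.
  by rewrite eqxx /= (can_in_eq gring_indexK) ?inE // eq_sym.
have one_stab : 1%g \in row_stab n la /\ 1%g \in col_stab n la.
  by split; rewrite inE; apply/forallP=> i; rewrite perm1.
rewrite /polytabloid /gring_row mxE mulmx_suml summxE.
have coef_r r : (regular_repr F [set: 'S_n] r
      *m (\sum_(c in col_stab n la) (-1) ^+ c *: regular_repr F [set: 'S_n] c))
        one one = \sum_(c in col_stab n la) (-1) ^+ c * (r * c == 1)%g%:R.
  rewrite mulmx_sumr summxE; apply: eq_bigr => c _.
  by rewrite -scalemxAr mxE coefM.
under eq_bigr => r _ do rewrite coef_r.
rewrite (bigD1 1%g) /=; last exact: one_stab.1.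
rewrite (bigD1 1%g) /=; last exact: one_stab.2.
rewrite mulg1 eqxx odd_perm1 expr0 mulr1 big1 ?addr0 => [|c /andP[_ c1]].
  rewrite big1 ?addr0 // => r /andP[rR r1]; apply: big1 => c cC.
  case: eqP => [rc|_]; last by rewrite mulr0.
  by move: r1; rewrite -[r]mulg1 -{1}(row_col_stab_eq1 rR cC rc) rc eqxx.
by rewrite mul1g (negPf c1) mulr0.
Qed.

(** The value at 1 is the image in [F] of the dimension of a nonzero module. *)
Lemma specht_char1_neq0 (F : fieldType) (n : nat) (la : seq nat) :
  [pchar F] =i pred0 -> specht_char F la (1%g : 'S_n) != 0.
Proof.
move=> F0; rewrite /specht_char repr_mx1 mxtrace1.
by rewrite ((pcharf0P F).1 F0) mxrank_eq0 cyclic_mx_eq0 polytabloid_neq0.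
Qed.

Section Stars.
Variables (n : nat) (e : rel 'I_n).
Hypothesis e_simple : simple_graph e.

(** The leaf set counted by [pendant_star_degree], for the very centre that the
    latter picks: a star with a single edge may have two centres, with different
    leaves. *)
Definition pendant_star_leaves (H : {set {set 'I_n}}) : {set 'I_n} :=
  if [pick c | star_centre e H c] is Some c then star_leaves e H c else set0.

Lemma pendant_star_leaves_centre H p0 :
  p0 \in pendant_star_leaves H ->
  exists2 c, star_centre e H c
    & forall p, p \in pendant_star_leaves H -> pendant e p /\ e p c.
Proof.
rewrite /pendant_star_leaves; case: pickP => [c cH _|_]; last by rewrite inE.
exists c => // p; rewrite inE => /andP[pp pcH]; split=> //.
have /forall_inP/(_ _ pcH)/existsP[q /and3P[_ eqc /eqP pq]] := cH.
suff -> : p = q by [].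
have: q \in [set p; c] by rewrite pq set21.
by case/set2P=> // qc; rewrite qc e_simple.2 in eqc.
Qed.

Lemma pendant_neighbour_uniq p u v : pendant e p -> e p u -> e p v -> u = v.
Proof.
move=> /cards1P[w pw] epu epv.
have /set1P-> : u \in [set w] by rewrite -pw inE.
by have /set1P-> : v \in [set w] by rewrite -pw inE.
Qed.

Lemma star_centre_concurrent H c f :
  star_centre e H c -> f \in H -> pendant_edge e f && (c \in f).
Proof.
move=> /forall_inP cH /cH/existsP[p /and3P[pp epc /eqP->]].
rewrite set22 andbT; apply/existsP; exists p; apply/existsP; exists c.
by rewrite pp epc eqxx.
Qed.

(** A common leaf forces a common centre, its only neighbour; the union of the
    two stars then still consists of pendant edges through that centre, so both
    stars equal it by maximality. *)
Lemma pendant_star_leaves_inj H K p :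
  H \in pendant_stars e -> K \in pendant_stars e ->
  p \in pendant_star_leaves H -> p \in pendant_star_leaves K -> H = K.
Proof.
rewrite !inE => /andP[_ /maxsetP[_ maxH]] /andP[_ /maxsetP[_ maxK]] pH pK.
have [c cH /(_ p pH)[pp epc]] := pendant_star_leaves_centre pH.
have [d dK /(_ p pK)[_ epd]] := pendant_star_leaves_centre pK.
rewrite -(pendant_neighbour_uniq pp epc epd) in dK.
have concHK : concurrent_pendant_edges e (H :|: K).
  apply/existsP; exists c; apply/forall_inP=> f /setUP[fH|fK].
    exact: star_centre_concurrent fH.
  exact: star_centre_concurrent fK.
by rewrite -(maxH _ concHK (subsetUl _ _)) (maxK _ concHK (subsetUr _ _)).
Qed.

(** Two leaves moved by [s] would both go to the centre, against injectivity:
    at most one leaf is lost. *)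
Lemma pendant_star_degree_fixed (s : 'S_n) H :
  (forall p, pendant e p -> s p != p -> e p (s p)) ->
  (pendant_star_degree e H
     <= #|pendant_star_leaves H :&: [set p | s p == p]|)%N.
Proof.
move=> s_adj.
have -> : pendant_star_degree e H = #|pendant_star_leaves H|.-1.
  rewrite /pendant_star_degree /pendant_star_leaves.
  by case: pickP => // _; rewrite cards0.
rewrite -(cardsID [set p | s p == p] (pendant_star_leaves H)) -subn1 leq_subLR.
rewrite addnC leq_add2r; apply/card_le1_eqP => p q.
rewrite !inE => /andP[sp pH] /andP[sq qH].
have [c _ leafH] := pendant_star_leaves_centre pH.
have [pp epc] := leafH p pH; have [pq eqc] := leafH q qH.
apply: (@perm_inj _ s).
by rewrite (pendant_neighbour_uniq pp (s_adj p pp sp) epc)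
  (pendant_neighbour_uniq pq (s_adj q pq sq) eqc).
Qed.

(** Summing the previous bound over the pendant stars counts each fixed pendant
    vertex at most once, as the leaf sets are disjoint. *)
Lemma star_degree_fixed (s : 'S_n) :
  (forall p, pendant e p -> s p != p -> e p (s p)) ->
  (star_degree e <= #|[set p | pendant e p & s p == p]|)%N.
Proof.
move=> s_adj; rewrite /star_degree.
apply: leq_trans.
  by apply: leq_sum => H _; apply: (@pendant_star_degree_fixed s).
have count_leaf H : #|pendant_star_leaves H :&: [set p | s p == p]|
    = (\sum_(p in [set p | pendant e p & s p == p])
         (p \in pendant_star_leaves H))%N.
  rewrite -sum1_card big_mkcond [RHS]big_mkcond; apply: eq_bigr => p _.
  rewrite !inE; case pH: (p \in _) => /=; last by case: ifP.
  have [c _ /(_ p pH)[-> _]] := pendant_star_leaves_centre pH.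
  by case: (s p == p).
under eq_bigr => H _ do rewrite count_leaf.
(* For each vertex, count the stars that have it as a leaf. *)
rewrite exchange_big /= -sum1_card; apply: leq_sum => p _.
rewrite -big_mkcondr sum1_card /=.
apply/card_le1_eqP => H K /andP[Hs pH] /andP[Ks pK].
exact: pendant_star_leaves_inj Ks Hs pK pH.
Qed.

End Stars.

Lemma dvdp_exp_card_prod (F : fieldType) (I : finType) (A : {set I})
    (d : {poly F}) (P : I -> {poly F}) :
  {in A, forall i, P i = d} -> (d ^+ #|A| %| \prod_i P i)%R.
Proof.
move=> PA; rewrite (bigID (mem A)) /= (eq_bigr (fun=> d)) //.
by rewrite prodr_const dvdp_mulr.
Qed.

Lemma dvdp_immanant (F : fieldType) (n : nat) (la : seq nat) (d : {poly F})
    (A : 'M[{poly F}]_n) :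
  (forall s : 'S_n, (d %| \prod_i A i (s i))%R) -> (d %| immanant la A)%R.
Proof.
move=> dA; rewrite /immanant.
apply: (big_ind (fun p => is_true (d %| p)%R)) => [|p q|s _].
- exact: dvdp0.
- exact: dvdp_add.
- by rewrite -mul_polyC dvdp_mull.
Qed.

(** The argument is purely algebraic: it works over any field of characteristic
    0, the characteristic entering through chi(1) only. *)
Lemma star_degree_le_mup (F : fieldType) (n : nat) (e : rel 'I_n)
    (la : seq nat) (b g : F) :
  [pchar F] =i pred0 -> simple_graph e ->
  (star_degree e <=
   mup b
     (immanant la
        ('X%:M - map_mx polyC (b *: degree_mx e F)
               - map_mx polyC (g *: adjacency_mx e F)
         : 'M[{poly F}]_n)))%N.
Proof.
move=> F0 e_simple.
rewrite mup_geq; last first.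
  apply/eqP=> imm0; have := @specht_char1_neq0 F n la F0.
  rewrite -(coef_immanant_charmx la
    (b *: degree_mx e F + g *: adjacency_mx e F)).
  by rewrite map_mxD opprD addrA imm0 coef0 eqxx.
set M := (X in immanant la X).
have entry i j : M i j = 'X *+ (i == j)
    - (b * ((deg e i)%:R *+ (i == j)))%:P - (g * (e i j)%:R)%:P.
  by rewrite !mxE.
apply: dvdp_immanant => s.
(* If the term of s does not vanish, each vertex that s moves goes along an edge. *)
have [/existsP[i s_off]|s_adj] := boolP [exists i, M i (s i) == 0].
  by rewrite (bigD1 i) //= (eqP s_off) mul0r dvdp0.
have adj p : pendant e p -> s p != p -> e p (s p).
  move=> _ sp; move/existsPn/(_ p): s_adj; apply: contraNT => /negPf nadj.
  by rewrite /= entry (eq_sym p) (negPf sp) nadj !mulr0n !mulr0 !subr0.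
apply: dvdp_trans (dvdp_exp2l _ (star_degree_fixed e_simple adj)) _.
apply: dvdp_exp_card_prod => p; rewrite inE => /andP[/eqP deg_p /eqP->].
by rewrite entry eqxx deg_p e_simple.2 !mulr1n mulr0 mulr1 subr0.
Qed.

Theorem theorem5p5 (R : realType) (n : nat) (e : rel 'I_n)
    (e_simple : simple_graph e) (e_conn : connected_graph e)
    (la : seq nat) (la_part : is_partition n la) (beta gamma : R) :
  (star_degree e <=
   mup beta%:C
     (immanant la
        ('X%:M - map_mx polyC (beta%:C *: degree_mx e R[i])
               - map_mx polyC (gamma%:C *: adjacency_mx e R[i])
         : 'M[{poly R[i]}]_n)))%N.
Proof. exact: (star_degree_le_mup _ _ _ (pchar_num _) e_simple). Qed.
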